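(* Let $(X,d)$ be a compact metric space and let $\Lambda$ be a finite nonempty set. If $X$ is generalized homogeneous, then the weak shadowing property (on $T$) is generic in $\mathcal{H}_{\Lambda}(X)$; that is, the set of all $\mathcal{F}\in\mathcal{H}_\Lambda(X)$ having the weak shadowing property contains a countable intersection of open dense subsets of $(\mathcal{H}_\Lambda(X),\rho)$.
   Context: A parameterized iterated function system (IFS) $\mathcal{F}=\{X; f_\lambda\mid\lambda\in\Lambda\}$ on a metric space $(X,d)$ is a family of continuous maps $f_\lambda:X\to X$, $\lambda\in\Lambda$, where $\Lambda$ is a finite nonempty set. Let $T=\mathbb{Z}$ or $T=\mathbb{Z}_+=\{n\in\mathbb{Z}: n\ge 0\}$. A sequence $\{x_n\}_{n\in T}$ in $X$ is an orbit of $\mathcal{F}$ if there exists $\sigma=\{\lambda_n\}_{n\in T}\in\Lambda^T$ such that $x_{n+1}=f_{\lambda_n}(x_n)$ for all $n\in T$. Given $\delta>0$, a sequence $\{x_n\}_{n\in T}$ in $X$ is a $\delta$-pseudo orbit of $\mathcal{F}$ if there exists $\{\lambda_n\}_{n\in T}\in\Lambda^T$ such that $d(x_{n+1},f_{\lambda_n}(x_n))<\delta$ for all $n\in T$. For $S\subset X$ and $\epsilon>0$, $B_\epsilon(S)$ denotes the set of all $x\in X$ such that $d(x,S)<\epsilon$. $\mathcal{F}$ has the weak shadowing property (on $T$) if for every $\epsilon>0$ there exists $\delta>0$ such that for every $\delta$-pseudo orbit $\mathbf{x}=\{x_n\}_{n\in T}$ of $\mathcal{F}$ there is an orbit $\mathbf{y}=\{y_n\}_{n\in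 T}$ of $\mathcal{F}$ with $\mathbf{y}\subset B_\epsilon(\mathbf{x})$ (sequences being identified with their sets of terms). $\mathcal{H}_\Lambda(X)$ is the set of all IFS $\mathcal{F}=\{X; f_\lambda\mid\lambda\in\Lambda\}$ such that each $f_\lambda$ is a homeomorphism of $X$, endowed with the metric $$\rho(\mathcal{F},\mathcal{G})=\max_{\lambda\in\Lambda}\max_{x\in X}\max\{d(f_\lambda(x),g_\lambda(x)),\,d(f_\lambda^{-1}(x),g_\lambda^{-1}(x))\}.$$ For homeomorphisms $f,g$ of $X$, let $d_0(f,g)=\max\{d(f(x),g(x)),\,d(f^{-1}(x),g^{-1}(x)): x\in X\}$. $X$ is generalized homogeneous if for every $\epsilon>0$ there is $\delta>0$ such that whenever $n\ge1$ and $\{x_1,\dots,x_n\},\{y_1,\dots,y_n\}\subset X$ are two sets of points, each consisting of $n$ pairwise distinct points, with $d(x_i,y_i)\le\delta$ for all $1\le i\le n$, there exists a homeomorphism $h:X\to X$ with $d_0(h,\mathrm{id}_X)\le\epsilon$ and $h(x_i)=y_i$ for $1\le i\le n$. *)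

(* Defs.v *)
From HB Require Import structures.
From mathcomp Require Import all_boot all_order all_algebra.
From mathcomp Require Import all_classical all_reals all_analysis.

Set Implicit Arguments.
Unset Strict Implicit.
Unset Printing Implicit Defensive.

Import Order.TTheory GRing.Theory Num.Theory.
Import numFieldNormedType.Exports.

Local Open Scope classical_set_scope.
Local Open Scope ring_scope.

Definition generic (T : topologicalType) (P : set T) : Prop :=
  exists U : nat -> set T,
    (forall n, open (U n) /\ dense (U n)) /\ \bigcap_n U n `<=` P.

(* The inverse map is part of the data; it is determined by [homeo_fun]
   (see [homeo_eq] below). *)
Record homeo (X : topologicalType) := Homeo {
  homeo_fun :> X -> X ;
  homeo_inv : X -> X ;
  homeoK : cancel homeo_fun homeo_inv ;
  homeo_invK : cancel homeo_inv homeo_fun ;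
  homeo_continuous : continuous homeo_fun ;
  homeo_inv_continuous : continuous homeo_inv }.

Lemma homeo_eq (X : topologicalType) (f g : homeo X) : f =1 g -> f = g.
Proof.
case: f g => [f f' fK f'K cf cf'] [g g' gK g'K cg cg'] /= /funext fg.
subst g; have f'g' : f' = g' by apply/funext => x; rewrite -[in LHS](g'K x) fK.
by subst g'; congr Homeo; exact: Prop_irrelevance.
Qed.

Definition homeo_id (X : topologicalType) : homeo X :=
  @Homeo X id id (fun=> erefl) (fun=> erefl)
    (fun x => cvg_id (F := nbhs x)) (fun x => cvg_id (F := nbhs x)).

Section pseudo_orbits.
Context {R : realType} {X : metricType R} {L : finType}.
Implicit Types (f : L -> X -> X) (S : set X).

(* The time set [T] is meant to be [int] or [nat]. *)
Definition ifs_orbit (T : nzSemiRingType) f (x : T -> X) : Prop :=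
  exists s : T -> L, forall n : T, x (n + 1) = f (s n) (x n).

Definition ifs_pseudo_orbit (T : nzSemiRingType) f (delta : R) (x : T -> X)
    : Prop :=
  exists s : T -> L, forall n : T, mdist (x (n + 1)) (f (s n) (x n)) < delta.

(* Only used for nonempty [S]: [inf set0 = 0]. *)
Definition dist_to_set (x : X) S : R := inf [set mdist x y | y in S].

Definition set_ball (e : R) S : set X := [set x | dist_to_set x S < e].

Definition weak_shadowing (T : nzSemiRingType) f : Prop :=
  forall e : R, 0 < e -> exists2 delta : R, 0 < delta &
    forall x : T -> X, ifs_pseudo_orbit f delta x ->
      exists2 y : T -> X, ifs_orbit f y & range y `<=` set_ball e (range x).

End pseudo_orbits.

(* Meant for compact [X], where the supremum is a maximum. *)
Definition homeo_dist (R : realType) (X : metricType R) (f g : homeo X) : R :=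
  sup (range (fun x : X => Num.max (mdist (f x) (g x))
                                   (mdist (homeo_inv f x) (homeo_inv g x)))).

Definition generalized_homogeneous (R : realType) (X : metricType R) : Prop :=
  forall e : R, 0 < e -> exists2 delta : R, 0 < delta &
    forall (n : nat) (x y : 'I_n -> X), (1 <= n)%N ->
      injective x -> injective y ->
      (forall i, mdist (x i) (y i) <= delta) ->
      exists2 h : homeo X, homeo_dist h (homeo_id X) <= e &
        forall i, h (x i) = y i.

(* The compactness proof is a parameter of the type because it is needed to
   equip the type with the metric [ifs_dist]. *)
Definition homeo_ifs (R : realType) (X : metricType R)
  (cptX : compact [set: X]) (L : finType) : Type := L -> homeo X.

Section ifs_metric.
Context {R : realType} {X : metricType R} (cptX : compact [set: X]).

Lemma compact_mdist_bounded : exists M : R, forall x y : X, mdist x y <= M.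
Proof.
have [[x0 _]|X0] := pselect (exists x : X, True); last first.
  by exists 0 => x; exfalso; apply: X0; exists x.
have /compact_near_coveringP/(_ R (+oo : set_system R)
    (fun M x => mdist x0 x <= M) _) := cptX.
case => [x _|M [_ /(_ (M + 1))]].
  exists (ball x 1, [set M | mdist x0 x + 1 < M]) => /=.
    split; first exact: nbhsx_ballx.
    by apply: nbhs_pinfty_gt; exact: num_real.
  move=> [y M] /= [+ xM]; rewrite ballEmdist /= => xy.
  by rewrite (le_trans (metric_triangle x0 x y))// ltW// (lt_trans _ xM)// ltrD2l.
rewrite ltrDl ltr01 => /(_ isT) HM.
exists ((M + 1) + (M + 1)) => x y.
rewrite (le_trans (metric_triangle x x0 y))// lerD ?HM//.
by rewrite metric_sym HM.
Qed.

Implicit Types f g h : homeo X.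

Let hd f g (x : X) := Num.max (mdist (f x) (g x))
                        (mdist (homeo_inv f x) (homeo_inv g x)).

Let hd_le f g x : hd f g x <= homeo_dist f g.
Proof.
have [M HM] := compact_mdist_bounded.
apply: ub_le_sup; last by exists x.
by exists M => _ [y _ <-]; rewrite ge_max !HM.
Qed.

Let homeo_dist_le f g (M : R) : 0 <= M -> (forall x, hd f g x <= M) ->
  homeo_dist f g <= M.
Proof.
move=> M0 HM; rewrite /homeo_dist.
have [->|/set0P S0] := eqVneq (range (hd f g)) set0; first by rewrite sup0.
by apply: (ge_sup S0) => _ [x _ <-]; exact: HM.
Qed.

Let homeo_dist_ge0 f g : 0 <= homeo_dist f g.
Proof.
have [[x _]|X0] := pselect (exists x : X, True).
  by rewrite (le_trans _ (hd_le f g x))// le_max mdist_ge0.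
have -> : homeo_dist f g = sup set0; last by rewrite sup0.
congr sup; apply/seteqP; split => // y [x _ _].
by apply: X0; exists x.
Qed.

Context {L : finType}.
Implicit Types F G H : homeo_ifs cptX L.

(* Every [homeo_dist] is nonnegative, so starting the maximum at 0 is harmless
   (and irrelevant when [L] is nonempty). *)
Definition ifs_dist F G : R := \big[Num.max/0]_(l : L) homeo_dist (F l) (G l).

Let le_ifs_dist F G l : homeo_dist (F l) (G l) <= ifs_dist F G.
Proof. exact: (le_bigmax_cond _ (fun l => homeo_dist (F l) (G l))). Qed.

Let ifs_dist_ge0 F G : 0 <= ifs_dist F G.
Proof. exact: bigmax_ge_id. Qed.

Lemma ifs_distxx F : ifs_dist F F = 0.
Proof.
apply/eqP; rewrite eq_le ifs_dist_ge0 andbT.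
apply: bigmax_le => // l _; apply: homeo_dist_le => // x.
by rewrite /hd !mdistxx maxxx.
Qed.

Lemma ifs_dist_positivity F G : ifs_dist F G = 0 -> F = G.
Proof.
move=> FG0; apply/funext => l; apply: homeo_eq => x; apply: mdist_positivity.
apply/eqP; rewrite eq_le mdist_ge0 andbT -FG0.
apply: le_trans (le_ifs_dist F G l); apply: le_trans (hd_le (F l) (G l) x).
by rewrite le_max lexx.
Qed.

Lemma ifs_dist_sym F G : ifs_dist F G = ifs_dist G F.
Proof.
apply: eq_bigr => l _; congr sup; apply: eq_imagel => x _.
by congr Num.max; exact: metric_sym.
Qed.

Lemma ifs_dist_triangle G F H : ifs_dist F H <= ifs_dist F G + ifs_dist G H.
Proof.
apply: bigmax_le => [|l _]; first by rewrite addr_ge0.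
apply: homeo_dist_le => [|x]; first by rewrite addr_ge0.
have FG := le_trans (hd_le (F l) (G l) x) (le_ifs_dist F G l).
have GH := le_trans (hd_le (G l) (H l) x) (le_ifs_dist G H l).
move: FG GH; rewrite /hd !ge_max => /andP[FG FG'] /andP[GH GH'].
apply/andP; split.
- by rewrite (le_trans (metric_triangle _ (G l x) _))// lerD.
- by rewrite (le_trans (metric_triangle _ (homeo_inv (G l) x) _))// lerD.
Qed.

HB.instance Definition _ := gen_eqMixin (homeo_ifs cptX L).
HB.instance Definition _ := gen_choiceMixin (homeo_ifs cptX L).
HB.instance Definition _ := @isMetric.Build R (homeo_ifs cptX L) ifs_dist
  ifs_distxx ifs_dist_positivity ifs_dist_sym ifs_dist_triangle.

End ifs_metric.

(* Main.v *)
Require Import Defs.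
From HB Require Import structures.
From mathcomp Require Import all_boot all_order all_algebra.
From mathcomp Require Import all_classical all_reals all_analysis.

(** The weak shadowing property asks for an orbit inside the [e]-neighborhood
    of the pseudo-orbit, with no converse inclusion.  In this form it holds for
    every IFS of continuous maps on a compact space, so that the countable
    intersection of open dense sets can be taken to be the whole space of IFS.

    The reason is a compactness argument.  If weak shadowing failed for some
    [e], there would be [1/(n+1)]-pseudo-orbits [x n] none of which has an orbit
    in its [e]-neighborhood.  Along an ultrafilter refining the convergence
    [n -> oo], every sequence [n |-> x n t] converges, say to [y t], and for
    each [t] the index of the map used at time [t] is eventually constant;
    passing to the limit in the pseudo-orbit inequality shows that [y] is an
    orbit ([ifs_orbit_ultralimit]).  The convergence of [x n t] to [y t] is not
    uniform in [t], but for many [n] all the [y t] are nevertheless [e]-close to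
    the set of terms of [x n] ([ultralimit_subset_set_ball]), which is the
    desired contradiction. *)

Set Implicit Arguments.
Unset Strict Implicit.
Unset Printing Implicit Defensive.

Import Order.TTheory GRing.Theory Num.Theory.
Import numFieldNormedType.Exports.
Import metricType_numDomainType.

Local Open Scope classical_set_scope.
Local Open Scope ring_scope.

(** A cluster point of the family is already a limit: the ultrafilter contains
    the preimage of each neighborhood or its complement, and the latter would
    keep the family away from the cluster point. *)
Lemma ultra_cvg_compact (I : Type) (G : set_system I) (X : topologicalType)
    (u : I -> X) :
  UltraFilter G -> compact [set: X] -> exists p : X, u @ G --> p.
Proof.
move=> UG cptX.
have [p [_ clp]] := cptX (u @ G) _ filterT.
exists p => V Vp.
have [//|GnV] := in_ultra_setVsetC (u @^-1` V) UG.
by have [q [/= nVq Vq]] := clp (~` V) V GnV Vp.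
Qed.

Lemma ultra_near_constant (I : Type) (G : set_system I) (J : finType)
    (a : I -> J) :
  UltraFilter G -> exists j, \forall i \near G, a i = j.
Proof.
move=> UG; apply: contrapT => noj.
have : \forall i \near G, forall j, a i <> j.
  apply: filter_forall => j.
  have [Gj|//] := in_ultra_setVsetC [set i | a i = j] UG.
  by exfalso; apply: noj; exists j.
by move/filter_ex => [i /(_ (a i))].
Qed.

Section ultralimits.
Context {R : realType} {X : metricType R} {L : finType}.
Context {I : Type} {G : set_system I} {UG : UltraFilter G}.

Lemma mem_set_ball (e : R) (S : set X) (p q : X) :
  S q -> mdist p q < e -> set_ball e S p.
Proof.
move=> Sq pq; apply: le_lt_trans pq; apply: ge_inf; last by exists q.
by exists 0 => _ [z _ <-]; exact: mdist_ge0.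
Qed.

(** Uniformity in [t] comes from compactness: near every point [p] of the space,
    the ultrafilter decides whether the sets [range (x i)] eventually meet a
    small ball around [p] or eventually avoid it.  In the first case the points
    near [p] are [e]-close to [range (x i)]; in the second case no [y t] is near
    [p].  Finitely many such neighborhoods cover the space. *)
Lemma ultralimit_subset_set_ball (T : Type) (x : I -> T -> X) (y : T -> X)
    (e : R) :
  compact [set: X] -> (forall t, x i t @[i --> G] --> y t) -> 0 < e ->
  \forall i \near G, range y `<=` set_ball e (range (x i)).
Proof.
move=> /compact_near_coveringP cptX xy e0.
have e2 : 0 < e / 2 by rewrite divr_gt0.
have e4 : 0 < e / 2 / 2 by rewrite divr_gt0.
pose avoided p :=
  \forall j \near G, forall t, ~ mdist p (x j t) < e / 2 / 2.
have : \forall i \near G,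
    [set: X] `<=` [set p | set_ball e (range (x i)) p \/ avoided p].
  apply: cptX => p _.
  have [meet|avoid] :=
      in_ultra_setVsetC [set i | exists t, mdist p (x i t) < e / 2] UG.
  - exists (ball p (e / 2), [set i | exists t, mdist p (x i t) < e / 2]).
      by split => //; exact: nbhsx_ballx.
    move=> [q i] [/= + [t pt]]; rewrite ballEmdist /= => pq; left.
    apply: (@mem_set_ball e _ q (x i t)); first by exists t.
    rewrite (le_lt_trans (metric_triangle q p (x i t)))// (splitr e) ltrD//.
    by rewrite metric_sym.
  - (* Half the avoided radius, so that every point of the smaller ball keeps
       an avoided ball of its own. *)
    exists (ball p (e / 2 / 2), setT).
      by split; [exact: nbhsx_ballx|exact: filterT].
    move=> [q i] [/= + _]; rewrite ballEmdist /= => pq; right.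
    apply: filterS avoid => j /= avoid t qt; apply: avoid; exists t.
    by rewrite (le_lt_trans (metric_triangle p q _))// (splitr (e / 2)) ltrD.
apply: filterS => i cover _ [t _ <-].
have [//|avoid] := cover (y t) Logic.I.
by have [j [yt /(_ t)]] :=
  filter_ex (filterI (cvgr_dist_lt (xy t) e4) avoid).
Qed.

(** For each [t] the ultrafilter selects one map index [s' t] among the finitely
    many, after which the limit of [x i (t + 1)] is compared with that of
    [f (s' t) (x i t)].  Each [t] is treated separately, so pointwise convergence is
    enough. *)
Lemma ifs_orbit_ultralimit (T : nzSemiRingType) (f : L -> X -> X)
    (delta : I -> R) (x : I -> T -> X) (y : T -> X) :
  (forall l, continuous (f l)) -> delta @ G --> (0 : R) ->
  (forall i, ifs_pseudo_orbit f (delta i) (x i)) ->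
  (forall t, x i t @[i --> G] --> y t) -> ifs_orbit f y.
Proof.
move=> cf delta0 /choice[s xs] xy.
have /choice[s' ss'] : forall t, exists l, \forall i \near G, s i t = l.
  by move=> t; exact: ultra_near_constant.
exists s' => t.
apply: (@cvg_unique _ (@metric_hausdorff R X) (x i (t + 1) @[i --> G])).
  exact: xy.
have fxy : f (s' t) (x i t) @[i --> G] --> f (s' t) (y t).
  exact: (continuous_cvg _ (cf (s' t) (y t)) (xy t)).
apply/cvgrPdist_lt => e e0.
have e2 : 0 < e / 2 by rewrite divr_gt0.
near=> i.
rewrite (le_lt_trans (metric_triangle _ (f (s' t) (x i t)) _))//.
rewrite (splitr e) ltrD//.
  by near: i; exact: cvgr_dist_lt.
rewrite metric_sym; apply: lt_trans (_ : delta i < _).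
  have <- : s i t = s' t by near: i; exact: ss'.
  exact: xs.
by near: i; exact: (cvgr_lt (0 : R)).
Unshelve. all: by end_near. Qed.

End ultralimits.

Lemma weak_shadowing_continuous (R : realType) (X : metricType R) (L : finType)
    (T : nzSemiRingType) (f : L -> X -> X) :
  compact [set: X] -> (forall l, continuous (f l)) -> weak_shadowing T f.
Proof.
move=> cptX cf e e0; apply: contrapT => noshadow.
have /choice[x bad] : forall n : nat, exists x : T -> X,
    ifs_pseudo_orbit f n.+1%:R^-1 x /\
    ~ exists2 y : T -> X, ifs_orbit f y & range y `<=` set_ball e (range x).
  move=> n.
  apply: contrapT => good; apply: noshadow; exists n.+1%:R^-1 => //.
  by move=> x px; apply: contrapT => noy; apply: good; exists x.
have [G [UG ooG]] := ultraFilterLemma (F := \oo) _.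
have /choice[y xy] : forall t, exists p : X, x n t @[n --> G] --> p.
  by move=> t; exact: ultra_cvg_compact.
have orby : ifs_orbit f y.
  apply: (ifs_orbit_ultralimit cf _ (fun n => (bad n).1) xy).
  by apply: cvg_trans (@cvg_harmonic R); exact: cvg_app.
have [n yx] := filter_ex (ultralimit_subset_set_ball cptX xy e0).
by apply: (bad n).2; exists y.
Qed.

Lemma generic_of_forall (T : topologicalType) (P : set T) :
  (forall t, P t) -> generic P.
Proof.
move=> allP; exists (fun=> setT); split; last by move=> t _; exact: allP.
move=> _; split; first exact: openT.
by move=> O O0 _; rewrite setIT.
Qed.

Theorem theorem3p8 (R : realType) (X : metricType R)
  (cptX : compact [set: X]) (L : finType) (L_gt0 : (0 < #|L|)%N)
  (homX : generalized_homogeneous X) :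
  generic [set F : homeo_ifs cptX L | weak_shadowing nat F] /\
  generic [set F : homeo_ifs cptX L | weak_shadowing int F].
Proof.
by split; apply: generic_of_forall => F;
  apply: weak_shadowing_continuous => // l; exact: homeo_continuous.
Qed.
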